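(* Let $(E,\xi)=\mathrm{ind}(E_n,\xi_n)$ be an inductive limit of a sequence $(E_n,\xi_n)_{n\in\mathbb{N}}$ of locally convex spaces. For each $n\in\mathbb{N}$, let $S_n$ be a pointed convex cone in $(E_n,\xi_n)$ with $\mathrm{int}_{\xi_n}S_n\neq\emptyset$. Assume moreover that the sequence $(S_n)_{n\in\mathbb{N}}$ is non-conflicting. If $A\subset E_1$ is nonempty and countably compact in $(E_1,\xi_1)$, then the set of lastingly weakly efficient points of $A$ with respect to the sequence $(S_n)_{n\in\mathbb{N}}$ is nonempty, i.e. $$\bigcap_{n=1}^{\infty} w\text{-}E_n(A,S_n)\neq\emptyset .$$
   Context: A locally convex space means a real locally convex Hausdorff topological vector space. Inductive limit: $(E_1,\xi_1)\subset(E_2,\xi_2)\subset\cdots$ is an increasing sequence of locally convex spaces, each $E_n$ being a proper linear subspace of $E_{n+1}$ with continuous inclusion $(E_n,\xi_n)\to(E_{n+1},\xi_{n+1})$; $E=\bigcup_{n=1}^\infty E_n$, and $\xi$ is the finest locally convex topology on $E$ making all inclusions $(E_n,\xi_n)\to E$ continuous. It is assumed throughout that $(E,\xi)$ is Hausdorff. A cone is a set $S$ (containing $0$) with $\alpha s\in S$ for all $s\in S$, $\alpha\ge 0$; it is a convex cone if in addition $S+S\subset S$, and pointed if $S\cap(-S)=\{0\}$. $\mathrm{int}_{\xi_n}$ and $\mathrm{cl}_{\xi_n}$ denote interior and closure in $(E_n,\xi_n)$. The sequence $(S_n)_{n\in\mathbb{N}}$ is non-conflicting if for each $n\in\mathbb{N}$,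 $$-S_j\not\subset \mathrm{cl}_{\xi_n}(S_1+S_2+\cdots+S_n)\quad\text{for all } j=1,2,\dots,n.$$ For nonempty $A\subset E_1$ and $n\in\mathbb{N}$, $w\text{-}E_n(A,S_n)$ is the set of all $a_0\in A$ such that $(A-a_0)\cap(-\mathrm{int}_{\xi_n}S_n)=\emptyset$. A lastingly weakly efficient point of $A$ with respect to $(S_n)_{n\in\mathbb{N}}$ is a point of $\bigcap_{n=1}^\infty w\text{-}E_n(A,S_n)$. A set is countably compact if every countable open cover of it has a finite subcover (equivalently, every sequence in it has a cluster point in it). *)

(* Defs.v *)
From HB Require Import structures.
From mathcomp Require Import all_boot all_order all_algebra.
From mathcomp Require Import all_classical all_reals all_analysis.

Set Implicit Arguments.
Unset Strict Implicit.
Unset Printing Implicit Defensive.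

Import Order.TTheory GRing.Theory Num.Theory.
Import numFieldNormedType.Exports.

Local Open Scope classical_set_scope.
Local Open Scope ring_scope.

(* Sequences indexed by 1, 2, ... in the source are indexed by 0, 1, ... here:
   the item of index n below is the item of index n + 1 of the source. *)

Section Topologies.
Context {R : realType} {E : lmodType R}.

Definition opens (tau : Topological.axioms_ E) : set_system E :=
  @open (Topological.Pack tau).

(* The fields are the axioms of [tvsType], stated for a topology [tau] that is
   not the canonical one of [E]. *)
Definition locally_convex_topology (tau : Topological.axioms_ E) : Prop :=
  let T := Topological.Pack tau in
  [/\ continuous ((fun x : E * E => x.1 + x.2) : T * T -> T),
      continuous ((fun z : R^o * E => z.1 *: z.2) : R^o * T -> T) &
      exists2 B : set_system E,
        (forall b, b \in B -> convex_set b) & basis (B : set_system T)].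

End Topologies.

(* The subspace E_n of E is the range of the injective linear map [inj n], and
   the space [E_ n] carries its own topology xi_n.  Each map [i] in
   [indlim_step] is then the inclusion of E_n into E_(n+1). *)
Record inductive_limit (R : realType) (E_ : nat -> tvsType R) (E : tvsType R)
    (inj : forall n, {linear E_ n -> E}) : Prop := InductiveLimit {
  indlim_inj : forall n, injective (inj n) ;
  indlim_proper : forall n, range (inj n) `<` range (inj n.+1) ;
  indlim_step : forall n (i : E_ n -> E_ n.+1),
    (forall x, inj n.+1 (i x) = inj n x) -> continuous i ;
  indlim_union : \bigcup_n range (inj n) = [set: E] ;
  indlim_continuous : forall n, continuous (inj n) ;
  indlim_finest : forall tau : Topological.axioms_ E,
    locally_convex_topology tau ->
    (forall n, continuous (inj n : E_ n -> Topological.Pack tau)) ->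
    opens tau `<=` open
}.

(* Interior and closure in F of a subset of the subspace [range f] of E. *)
Definition int_via {F : topologicalType} {E : Type} (f : F -> E) (X : set E) :
  set E := f @` interior (f @^-1` X).

Definition cl_via {F : topologicalType} {E : Type} (f : F -> E) (X : set E) :
  set E := f @` closure (f @^-1` X).

Section Cones.
Context {R : realType} {E : lmodType R}.
Implicit Types S A : set E.

Definition cone S : Prop :=
  S 0 /\ forall (a : R) s, 0 <= a -> S s -> S (a *: s).

Definition convex_cone S : Prop :=
  cone S /\ [set s + t | s in S & t in S] `<=` S.

Definition pointed S : Prop := S `&` (-%R @` S) = [set 0].

Definition sum_upto (S : nat -> set E) (n : nat) : set E :=
  [set \sum_(i < n.+1) s i | s in
    [set s : 'I_n.+1 -> E | forall i : 'I_n.+1, S i (s i)]].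

Definition non_conflicting {E_ : nat -> topologicalType}
    (inj : forall n, E_ n -> E) (S : nat -> set E) : Prop :=
  forall n k, (k <= n)%N ->
    ~ (-%R @` S k `<=` cl_via (inj n) (sum_upto S n)).

Definition weakly_efficient {F : topologicalType} (f : F -> E) A S : set E :=
  [set a0 | A a0 /\
     [set a - a0 | a in A] `&` (-%R @` int_via f S) = set0].

Definition lastingly_weakly_efficient {E_ : nat -> topologicalType}
    (inj : forall n, E_ n -> E) A (S : nat -> set E) : set E :=
  \bigcap_n weakly_efficient (inj n) A (S n).

End Cones.

(* [cover_compact] restricted to countable covers. *)
Definition countably_compact {T : topologicalType} (A : set T) : Prop :=
  forall (I : choiceType) (D : set I) (f : I -> set T), countable D ->
    (forall i, D i -> open (f i)) -> A `<=` cover D f ->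
    finite_subset_cover D f A.

(* Main.v *)
Require Import Defs.
From HB Require Import structures.
From mathcomp Require Import all_boot all_order all_algebra.
From mathcomp Require Import all_classical all_reals all_analysis.

Set Implicit Arguments.
Unset Strict Implicit.
Unset Printing Implicit Defensive.

Import Order.TTheory GRing.Theory Num.Theory.
Import numFieldNormedType.Exports.

Local Open Scope classical_set_scope.
Local Open Scope ring_scope.

(** The theorem is an optimization of a scalar function on [A], in disguise.
For [x] in the first space, let [P n x] mean that the image of [x] in the
[n]-th space is interior to the [n]-th cone; [P n] is open because the
inclusions are continuous.  A point [x] of [A] fails to be lastingly weakly
efficient exactly when [x - a] is in [P n] for some [n] and some [a] in [A].

If every point failed, the open sets [A + P n] would cover [A], so by countable
compactness finitely many of them, of index at most [M], would suffice.  Only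
[S 0, ..., S M] then matter.  Let [K] be the trace on the first space of the
closure in the [M]-th space of [S 0 + ... + S M]: it is a closed convex cone
whose interior contains [P 0, ..., P M].  One of these contains a point [e], and
non-conflict forces [- e] out of [K] ([non_conflicting_opp_interior]): if [x] is
interior to [S j] and [- x] is in the closed sum [C], then
[- t *: s = (x - t *: s) - x] is in [C] for each [s] in [S j] and small [t > 0],
whence [- S j] is included in [C].

It remains to find [x] in [A] such that [x - a] is interior to [K] for no [a]
in [A] ([countably_compact_weakly_minimal]); this contradicts the finite cover.
Such an [x] is a minimizer on [A] of the Gerstewitz functional
[x |-> sup [set t | x - t *: e \in K]], which strictly decreases along the
interior of [K].  No separation theorem is needed, because all the cones [P n]
with [n <= M] are open in the same space and lie in the interior of the same
cone [K]. *)

(** * Countable compactness *)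

Lemma countably_compact_nondecreasing_cover {T : topologicalType} (B : set T)
    (f : nat -> set T) :
  countably_compact B -> (forall n, open (f n)) ->
  (forall m n, (m <= n)%N -> f m `<=` f n) ->
  B `<=` \bigcup_n f n -> exists n, B `<=` f n.
Proof.
move=> ccB fo fmono Bf.
have [D _ BD] := ccB nat setT f (countableP _) (fun n _ => fo n) Bf.
exists (\max_(i <- finmap.enum_fset D) i)%N => x /BD[i /= iD fix_].
by apply: fmono fix_; apply: (@leq_bigmax_seq _ _ xpredT id).
Qed.

(** * Cones in a topological vector space *)

Section TopologicalVectorSpace.
Context {R : realType} {F : tvsType R}.
Implicit Types (K U : set F) (u v x y : F).

Lemma continuous_addl v : continuous (fun x : F => v + x).
Proof.
move=> x; apply: (@continuous2_cvg _ F F F _ _ (fun=> v) id (fun x y => x + y)).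
- exact: (@add_continuous F (v, x)).
- exact: cvg_cst.
- exact: cvg_id.
Qed.

Lemma continuous_scalel (a : R) : continuous (fun x : F => a *: x).
Proof.
move=> x; apply: (@continuous2_cvg _ R^o F F _ _ (fun=> a) id
  (fun a x => a *: x)).
- exact: (@scale_continuous R F (a, x)).
- exact: cvg_cst.
- exact: cvg_id.
Qed.

Lemma cvg_small_translate u v :
  (fun n : nat => u + n.+1%:R^-1 *: v) @ \oo --> u.
Proof.
have h : (fun n : nat => n.+1%:R^-1 *: v) @ \oo --> (0 : F).
  rewrite -(scale0r v).
  apply: (@continuous2_cvg _ R^o F F _ _ (fun n : nat => n.+1%:R^-1) (fun=> v)
    (fun a x => a *: x)).
  - exact: (@scale_continuous R F (0, v)).
  - exact: (@cvg_harmonic R).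
  - exact: cvg_cst.
rewrite -{2}(addr0 u).
exact: (cvg_comp _ _ h (@continuous_addl u 0)).
Qed.

(** A neighborhood of [u] is entered from [u] in every direction [v], along the
steps [1 / (n + 1)]. *)
Lemma open_small_translate U u v :
  nbhs u U -> exists n : nat, U (u + n.+1%:R^-1 *: v).
Proof.
move=> uU; have [n _ /(_ n (leqnn n))] := @cvg_small_translate u v _ uU.
by exists n.
Qed.

Lemma closure_convex_cone K : convex_cone K -> convex_cone (closure K).
Proof.
move=> [[K0 KZ] KD]; split; first split.
- exact: subset_closure.
- move=> a x a0 Kx B /(@continuous_scalel a x)/Kx[y [Ky By]].
  by exists (a *: y); split=> //; exact: KZ.
- move=> _ [x Kx [y Ky <-]] B.
  move=> /(@add_continuous F (x, y))[[/= B1 B2] [xB1 yB2] B12].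
  have [x' [Kx' B1x']] := Kx _ xB1; have [y' [Ky' B2y']] := Ky _ yB2.
  exists (x' + y'); split; first by apply: KD; exists x' => //; exists y'.
  exact: (B12 (x', y')).
Qed.

Lemma interior_add_cone K x y :
  convex_cone K -> interior K x -> K y -> interior K (x + y).
Proof.
move=> [_ KD] Kx Ky.
have : nbhs (x + y) ((fun z => - y + z) @^-1` K).
  by apply: continuous_addl; rewrite addrC addrK.
apply: filterS => z Kz.
by apply: KD; exists (- y + z) => //; exists y => //; rewrite addrC addNKr.
Qed.

Lemma interior_scale_cone K (a : R) x :
  convex_cone K -> 0 < a -> interior K x -> interior K (a *: x).
Proof.
move=> [[_ KZ] _] a0 Kx.
have : nbhs (a *: x) ((fun z => a^-1 *: z) @^-1` K).
  by apply: continuous_scalel; rewrite scalerA mulVf ?gt_eqF// scale1r.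
apply: filterS => z /= Kz.
rewrite -(scale1r z) -(mulfV (lt0r_neq0 a0)) -scalerA.
by apply: KZ => //; exact: ltW.
Qed.

(** For a closed convex cone [K] with [e] interior and [- e] outside, a nonempty
countably compact set has a weakly minimal point.  With [f t] the translate of the interior of [K] by
[t *: e], the infimum over [B] of the Gerstewitz functional of [K] and [e] is
[sup [set t | B `<=` f t]], and a point of [B] outside [f s], for that supremum
[s], is a minimizer. *)
Lemma countably_compact_weakly_minimal K (e : F) (B : set F) :
  convex_cone K -> closed K -> interior K e -> ~ K (- e) ->
  countably_compact B -> B !=set0 ->
  exists2 x, B x & forall y, B y -> ~ interior K (x - y).
Proof.
move=> coneK clK eK NeK ccB [b Bb].
have [[_ KZ] _] := coneK.
have Ke : K e by exact: interior_subset.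
have openQ v : open [set x | interior K (v + x)].
  apply: (@open_comp _ _ (fun x => v + x)); last exact: open_interior.
  by move=> x _; exact: continuous_addl.
pose f (t : R) := [set x | interior K (- (t *: e) + x)].
have fdown (s t : R) : s <= t -> f t `<=` f s.
  move=> st x fx; rewrite /f /=.
  have -> : - (s *: e) + x = - (t *: e) + x + (t - s) *: e.
    by rewrite scalerBl addrACA addNr add0r addrC.
  by apply: interior_add_cone => //; apply: KZ; rewrite ?subr_ge0.
pose T := [set t : R | B `<=` f t].
have Tsup : has_sup T.
  split.
  (* Nonempty: the sets [f (- (n + 1))] increase to the whole space. *)
  - have [|m n mn||n Bn] := @countably_compact_nondecreasing_cover F B
      (fun n => f (- n.+1%:R)) ccB; [by move=> n; exact: openQ| | |].
    + by apply: fdown; rewrite lerN2 ler_nat.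
    + move=> x _; have [n nK] := open_small_translate x (nbhs_interior eK).
      exists n => //; rewrite /f /= scaleNr opprK.
      have n0 : 0 < (n.+1%:R : R) by rewrite ltr0n.
      have := interior_scale_cone coneK n0 nK.
      by rewrite scalerDr scalerA mulfV ?scale1r// gt_eqF.
    + by exists (- n.+1%:R).
  (* Bounded above: otherwise [b / t - e] would be in [K] for large [t]. *)
  - have NK : nbhs (- e) (~` K).
      by apply: open_nbhs_nbhs; split=> //; exact: closed_openC.
    have [n nK] := open_small_translate b NK.
    exists n.+1%:R => t /(_ b Bb) ftb; rewrite leNgt; apply/negP => nt.
    apply: nK.
    have := fdown _ _ (ltW nt) _ ftb => /interior_subset.
    have n0 : 0 <= (n.+1%:R : R)^-1 by rewrite invr_ge0.
    move=> /(KZ _ _ n0); rewrite scalerDr scalerN scalerA mulVf ?scale1r//.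
pose s := sup T.
(* The infimum is attained: [f s] is the increasing union of the sets
   [f (s + 1 / (n + 1))], none of which contains [B]. *)
have [a0 Ba0 Na0] : exists2 x, B x & ~ f s x.
  apply: contrapT => H.
  have Bs : B `<=` f s.
    by move=> x Bx; apply: contrapT => Nx; apply: H; exists x.
  have [|m n mn||n Bn] := @countably_compact_nondecreasing_cover F B
      (fun n => f (s + n.+1%:R^-1)) ccB; [by move=> n; exact: openQ| | |].
  - by apply: fdown; rewrite lerD2l lef_pV2 ?posrE ?ltr0n// ler_nat.
  - move=> x /Bs fx.
    have [n nK] := open_small_translate (- e) (nbhs_interior fx).
    rewrite scalerN in nK; exists n => //.
    by rewrite /f /= scalerDl opprD addrAC.
  - have := sup_upper_bound Tsup Bn.
    by rewrite /= gerDl leNgt invr_gt0 ltr0n.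
(* If [a0 - y] were interior to [K], so would be [a0 - y - d *: e] for some
   [d > 0], and [y \in f t] with [t > s - d] would give [a0 \in f s]. *)
exists a0 => // y By Ky; apply: Na0.
have [n nK] := open_small_translate (- e) (nbhs_interior Ky).
have n0 : 0 < (n.+1%:R : R)^-1 by rewrite invr_gt0 ltr0n.
have [t Tt st] := sup_adherent n0 Tsup.
apply: (fdown _ (t + n.+1%:R^-1)); first by rewrite -lerBlDr ltW.
rewrite /f /=.
have := interior_add_cone coneK nK (interior_subset (Tt y By)).
congr (interior K _).
rewrite scalerDl opprD scalerN.
by rewrite addrAC [_ + y]addrC addrA subrK -addrA addrC.
Qed.

End TopologicalVectorSpace.

(** * Cones and inclusions in an inductive limit *)

Section Inclusions.
Context {R : realType}.

Lemma convex_cone_preimage {U V : lmodType R} (f : {linear U -> V})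
    (C : set V) :
  convex_cone C -> convex_cone (f @^-1` C).
Proof.
move=> [[C0 CZ] CD]; split; first split.
- by rewrite /= linear0.
- by move=> a x a0 Cx /=; rewrite linearZ; exact: CZ.
- move=> _ [x Cx [y Cy <-]] /=; rewrite linearD.
  by apply: CD; exists (f x) => //; exists (f y).
Qed.

Lemma sum_upto_sub {E : lmodType R} (S : nat -> set E) (k n : nat) :
  (forall i, S i 0) -> (k <= n)%N -> S k `<=` sum_upto S n.
Proof.
move=> S0 kn x Sx; pose j := Ordinal (kn : (k < n.+1)%N).
exists (fun i => if i == j then x else 0).
  by move=> i; case: eqVneq => [->|].
by rewrite -big_mkcond big_pred1_eq.
Qed.

Lemma convex_cone_sum_upto {E : lmodType R} (S : nat -> set E) (n : nat) :
  (forall i, convex_cone (S i)) -> convex_cone (sum_upto S n).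
Proof.
move=> coneS; split; first split.
- exists (fun=> 0); first by move=> i; have [[]] := coneS i.
  by rewrite big1.
- move=> a _ a0 [s Ss <-]; exists (fun i => a *: s i).
    by move=> i; have [[_ +] _] := coneS i; apply.
  by rewrite scaler_sumr.
- move=> _ [_ [s Ss <-] [_ [t St <-] <-]]; exists (fun i => s i + t i).
    move=> i; have [_] := coneS i; apply.
    by exists (s i) => //; exists (t i).
  by rewrite big_split.
Qed.

(** The inclusion of the [m]-th space in the [n]-th one, for [m <= n], as a
continuous linear map between the two spaces. *)
Lemma inductive_limit_inclusion {E_ : nat -> tvsType R} {E : tvsType R}
    (inj : forall n, {linear E_ n -> E}) (limE : inductive_limit inj)
    (m n : nat) :
  (m <= n)%N ->
  exists2 i : {linear E_ m -> E_ n},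
    continuous i & forall x, inj n (i x) = inj m x.
Proof.
elim: n => [|n IH].
  by rewrite leqn0 => /eqP ->; exists idfun => // x; exact: cvg_id.
rewrite leq_eqVlt ltnS => /predU1P[->|/IH[i ci inji]].
  by exists idfun => // x; exact: cvg_id.
have /choice[j injj] : forall x : E_ n,
    exists y : E_ n.+1, inj n.+1 y = inj n x.
  move=> x.
  have [+ _] := indlim_proper limE n => /(_ (inj n x)).
  case=> [|y _ <-]; first by exists x.
  by exists y.
have linj : linear j.
  by move=> a x y; apply: (indlim_inj limE); rewrite linearP !injj linearP.
pose jL := GRing.isLinear.Build _ _ _ _ j linj.
pose j' : {linear E_ n -> E_ n.+1} := HB.pack j jL.
exists (j' \o i) => [x|x]; last by rewrite /= injj.
apply: continuous_comp; [exact: ci|exact: (indlim_step limE injj)].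
Qed.

End Inclusions.

(** For a non-conflicting sequence and [m <= n], no point interior to [S m] has
its opposite in the closure of [S 0 + ... + S n]. *)
Lemma non_conflicting_opp_interior (R : realType) (E_ : nat -> tvsType R)
    (E : tvsType R) (inj : forall n, {linear E_ n -> E}) (S : nat -> set E)
    (m n : nat) (i : {linear E_ m -> E_ n}) (x : E_ m) :
  (forall k, convex_cone (S k)) -> (forall k, S k `<=` range (inj k)) ->
  non_conflicting inj S -> (m <= n)%N ->
  (forall y, inj n (i y) = inj m y) ->
  interior (inj m @^-1` S m) x ->
  ~ closure (inj n @^-1` sum_upto S n) (- i x).
Proof.
move=> coneS subS ncS mn inji xint Cx.
have coneC : convex_cone (closure (inj n @^-1` sum_upto S n)).
  by apply: closure_convex_cone; apply: convex_cone_preimage;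
    exact: convex_cone_sum_upto.
have [[C0 CZ] CD] := coneC.
apply: (ncS n m mn) => _ [s Ss <-].
have [s' _ ss'] := subS m s Ss.
have [k kS] := open_small_translate (- s') xint.
have k0 : (0 : R) <= k.+1%:R by [].
exists (- i s'); last by rewrite linearN inji ss'.
have : closure (inj n @^-1` sum_upto S n) (i (x + k.+1%:R^-1 *: - s')).
  apply: subset_closure; rewrite /= inji.
  by apply: (sum_upto_sub _ mn) kS => j; have [[]] := coneS j.
move=> Cxs.
have /(CZ _ _ k0) := CD _ (ex_intro2 _ _ _ Cxs (ex_intro2 _ _ _ Cx erefl)).
by rewrite [i (x + _)]linearD addrAC subrr add0r [i (_ *: _)]linearZ linearN
  scalerA mulfV ?scale1r.
Qed.

(** * Existence of lastingly weakly efficient points *)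

Theorem theorem2p1 (R : realType) (E_ : nat -> tvsType R) (E : tvsType R)
    (inj : forall n, {linear E_ n -> E})
    (hausE_ : forall n, hausdorff_space (E_ n))
    (limE : inductive_limit inj)
    (hausE : hausdorff_space E)
    (S : nat -> set E)
    (subS : forall n, S n `<=` range (inj n))
    (coneS : forall n, convex_cone (S n))
    (pointedS : forall n, pointed (S n))
    (intS : forall n, int_via (inj n) (S n) !=set0)
    (ncS : non_conflicting inj S)
    (A : set E)
    (subA : A `<=` range (inj 0%N))
    (A0 : A !=set0)
    (ccA : countably_compact (inj 0%N @^-1` A)) :
  lastingly_weakly_efficient inj A S !=set0.
Proof.
pose B := inj 0%N @^-1` A.
have B0 : B !=set0.
  have [a Aa] := A0; have [b _ ba] := subA _ Aa.
  by exists b; rewrite /B /= ba.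
pose i n := sval (cid2 (inductive_limit_inclusion limE (leq0n n))).
have ci n : continuous (i n) by rewrite /i; case: cid2.
have inji n x : inj n (i n x) = inj 0%N x by rewrite /i; case: cid2 => /=.
pose P n : set (E_ 0%N) := i n @^-1` interior (inj n @^-1` S n).
have openP n : open (P n).
  by apply: open_comp; [move=> x _; exact: ci|exact: open_interior].
(* An inefficient point is one from which some point of [B] differs by a
   point of some [P n]; from here on the argument takes place in [E_ 0]. *)
suff [a0 Ba0 Na0] : exists2 a0, B a0 & forall n a, B a -> ~ P n (a0 - a).
  exists (inj 0%N a0) => n _; split => //.
  apply/seteqP; split => // _ [[a Aa <-] [_ [y yint <-] ya]].
  have [b _ ba] := subA _ Aa.
  apply: (Na0 n b); first by rewrite /B /= ba.
  rewrite /P /= (_ : i n (a0 - b) = y)//; apply: (indlim_inj limE).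
  by rewrite inji linearB ba -[RHS]opprK ya opprB.
apply: contrapT => H.
have {H} BP x : B x -> exists n, exists2 a, B a & P n (x - a).
  move=> Bx; apply: contrapT => Nx; apply: H; exists x => // n a Ba Pxa.
  by apply: Nx; exists n, a.
(* Some [P m] is nonempty, since [B] is. *)
have [m [e Pe]] : exists m e, P m e.
  by have [b /BP[m [a _ Pba]]] := B0; exists m, (b - a).
pose V N := \bigcup_(n in [set n | (n <= N)%N])
  \bigcup_(a in B) [set x | P n (- a + x)].
have [|M N MN x [n nM Vx]||N BV] :=
  countably_compact_nondecreasing_cover (f := V) ccA.
- move=> N; apply: bigcup_open => n _; apply: bigcup_open => a _.
  by apply: open_comp (openP n) => x _; exact: continuous_addl.
- by exists n => //; exact: leq_trans nM MN.
- move=> x /BP[n [a Ba Pxa]]; exists n => //; exists n => //=.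
  by exists a => //=; rewrite addrC.
(* [M] bounds both the finite subcover and the index of [e]. *)
pose M := maxn N m.
pose C := closure (inj M @^-1` sum_upto S M).
have coneC : convex_cone C.
  by apply: closure_convex_cone; apply: convex_cone_preimage;
    exact: convex_cone_sum_upto.
have PC n : (n <= M)%N -> P n `<=` interior (i M @^-1` C).
  move=> nM; rewrite -open_subsetE// => x /interior_subset Sx.
  apply: subset_closure; rewrite /= inji -(inji n).
  by apply: (sum_upto_sub _ nM) Sx => j; have [[]] := coneS j.
have [||||x Bx xmin] := @countably_compact_weakly_minimal R (E_ 0%N)
  (i M @^-1` C) e B _ _ _ _ ccA B0.
- exact: convex_cone_preimage.
- by apply: closed_comp; [move=> x _; exact: ci|exact: closed_closure].
- by apply: (PC m) => //; exact: leq_maxr.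
- have [j _ injj] := inductive_limit_inclusion limE (leq_maxr N m).
  rewrite /= linearN (_ : i M e = j (i m e)).
    have := leq_maxr N m => mM.
    exact: (non_conflicting_opp_interior coneS subS ncS mM injj Pe).
  by apply: (indlim_inj limE); rewrite injj !inji.
have [n nN [a Ba Pxa]] := BV x Bx.
apply: (xmin a Ba); apply: (PC n); first exact: leq_trans nN (leq_maxl _ _).
by rewrite addrC.
Qed.
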